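(* A two-dimensional subalgebra of $\mathfrak{b}$ which does not contain any nonzero semisimple elements, but whose elements are not all nilpotent, must be equivalent to one of the following inequivalent algebras: $$\langle T_{1,1}+X_{\beta},X_{\alpha+2\beta}\rangle,\qquad \langle T_{1,0}+X_{\alpha},X_{\alpha+\beta}\rangle,\qquad \langle T_{1,0}+X_{\alpha},X_{\alpha+2\beta}\rangle .$$
   Context: Let $J=\begin{pmatrix}0&0&1&0\\0&0&0&1\\-1&0&0&0\\0&-1&0&0\end{pmatrix}$. $\mathfrak{sp}(4,\mathbb{C})$ is the Lie algebra of $4\times4$ complex matrices $X$ with $JX^tJ=X$, and $Sp(4,\mathbb{C})=\{g\in GL(4,\mathbb{C}) : gJg^t=J\}$, acting on $\mathfrak{sp}(4,\mathbb{C})$ by conjugation $X\mapsto gXg^{-1}$. Elements are semisimple (nilpotent) if they are so as matrices. For $a,b\in\mathbb{C}$, $T_{a,b}=\mathrm{diag}(a,b,-a,-b)$, and $\mathfrak{t}=\{T_{a,b}: a,b\in\mathbb{C}\}$. With $E_{ij}$ the matrix units, $X_\alpha=E_{24}$, $X_\beta=E_{12}-E_{43}$, $X_{\alpha+\beta}=E_{14}+E_{23}$, $X_{\alpha+2\beta}=E_{13}$. $\langle\,\cdot\,\rangle$ denotes the complex linear span. $\mathfrak{b}=\mathfrak{t}\oplus\langle X_\alpha,X_\beta,X_{\alpha+\beta},X_{\alpha+2\beta}\rangle$ is the Borel subalgebra. Two subalgebras are equivalent if some $g\in Sp(4,\mathbb{C})$ conjugates one onto the other. *)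

(* Defs.v *)
From HB Require Import structures.
From mathcomp Require Import all_boot all_order all_algebra.

Set Implicit Arguments.
Unset Strict Implicit.
Unset Printing Implicit Defensive.

Import GRing.Theory.
Local Open Scope ring_scope.

Section Sp4.
Variable F : fieldType.

Definition J : 'M[F]_4 :=
  \matrix_(i, j) nth 0 (nth [::] [:: [::  0;  0; 1; 0];
                                     [::  0;  0; 0; 1];
                                     [:: -1;  0; 0; 0];
                                     [::  0; -1; 0; 0]] i) j.

Definition sp4 : {pred 'M[F]_4} := [pred X | J *m X^T *m J == X].

Definition Sp4 : {pred 'M[F]_4} :=
  [pred g | (g \in unitmx) && (g *m J *m g^T == J)].

Definition Tmx (a b : F) : 'M[F]_4 :=
  diag_mx (\row_j nth 0 [:: a; b; -a; -b] j).

Definition cartan : {vspace 'M[F]_4} := <<[:: Tmx 1 0; Tmx 0 1]%R>>%VS.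

Lemma mem_cartanP (X : 'M[F]_4) :
  reflect (exists a b : F, X = Tmx a b) (X \in cartan).
Proof.
have TmxE a b : Tmx a b = a *: Tmx 1 0 + b *: Tmx 0 1.
  apply/matrixP=> i j; rewrite !mxE.
  case: i => [[|[|[|[|]]]] //= ?]; case: j => [[|[|[|[|]]]] //= ?];
  by rewrite ?mulr1n ?mulr0n ?oppr0 ?mulr0 ?mulr1 ?mulrN1 ?addr0 ?add0r.
rewrite /cartan span_cons span_seq1; apply: (iffP idP).
  case/memv_addP=> _ /vlineP[a ->] [_ /vlineP[b ->] ->].
  by exists a, b; rewrite -TmxE.
by case=> a [b ->]; rewrite TmxE memv_add ?memvZ ?memv_line.
Qed.

(* Indices of delta_mx start at 0: E_{24} is delta_mx 1 3. *)
Definition X_alpha : 'M[F]_4 := delta_mx 1 3.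
Definition X_beta : 'M[F]_4 := delta_mx 0 1 - delta_mx 3 2.
Definition X_alpha_beta : 'M[F]_4 := delta_mx 0 3 + delta_mx 1 2.
Definition X_alpha_2beta : 'M[F]_4 := delta_mx 0 2.

Definition borel : {vspace 'M[F]_4} :=
  (cartan + <<[:: X_alpha; X_beta; X_alpha_beta; X_alpha_2beta]%R>>)%VS.

Definition is_subalgebra (V : {vspace 'M[F]_4}) : Prop :=
  {subset V <= sp4} /\
  (forall X Y, X \in V -> Y \in V -> X *m Y - Y *m X \in V).

Definition equivalent (V W : {vspace 'M[F]_4}) : Prop :=
  exists2 g, g \in Sp4 &
    forall Y, Y \in W <-> exists2 X, X \in V & Y = g *m X *m invmx g.

(* Over an algebraically closed field a matrix is semisimple exactly when
   it is diagonalizable; this definition is only meant for such F. *)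
Definition semisimple_mx (X : 'M[F]_4) : Prop := diagonalizable X.

Definition nilpotent_mx (X : 'M[F]_4) : Prop := exists k : nat, X ^+ k = 0.

Definition alg1 : {vspace 'M[F]_4} :=
  <<[:: Tmx 1 1 + X_beta; X_alpha_2beta]%R>>%VS.
Definition alg2 : {vspace 'M[F]_4} :=
  <<[:: Tmx 1 0 + X_alpha; X_alpha_beta]%R>>%VS.
Definition alg3 : {vspace 'M[F]_4} :=
  <<[:: Tmx 1 0 + X_alpha; X_alpha_2beta]%R>>%VS.

End Sp4.

Arguments alg1 F : clear implicits.
Arguments alg2 F : clear implicits.
Arguments alg3 F : clear implicits.
Arguments borel F : clear implicits.

(* Main.v *)
(* A non-nilpotent x in V has nonzero torus part T. Conjugating by the root
   subgroups exp(c X_gamma) removes from x the coefficients at the positive roots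
   gamma with gamma(T) <> 0, leaving the Jordan decomposition x = T + N with
   [T, N] = 0. If the torus projection of V were surjective, V would contain an
   element with regular torus part, conjugate to a diagonal matrix; hence V is
   spanned by x and a strictly triangular y, and [x, y] = l y. As x is not
   semisimple, exactly one positive root kills T, and the eigenvector equation
   leaves at most three lines for y. Weyl group elements and a torus rescaling
   bring the resulting pairs to the three models. These are told apart by
   containing an invertible matrix (only the first one) and a matrix of rank one
   (the third one but not the second one). *)
Require Import Defs.
From mathcomp Require Import all_boot all_order all_algebra.
From mathcomp Require Import reals.
From mathcomp.real_closed Require Import complex.
From mathcomp Require Import ring.

Set Implicit Arguments.
Unset Strict Implicit.
Unset Printing Implicit Defensive.

Import GRing.Theory Num.Theory.
Local Open Scope ring_scope.

(** * Explicit four-by-four matrices and coordinates on the Borel subalgebra *)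

Definition mx4 {F : fieldType} (rows : seq (seq F)) : 'M[F]_4 :=
  \matrix_(i, j) nth 0 (nth [::] rows i) j.

(* T_{a,b} + p X_alpha + q X_beta + r X_{alpha+beta} + s X_{alpha+2beta} *)
Definition bor {F : fieldType} (a b p q r s : F) : 'M[F]_4 :=
  mx4 [:: [:: a; q; s; r]; [:: 0; b; r; p]; [:: 0; 0; - a; 0]; [:: 0; 0; - q; - b]].

Ltac mx4_cases i j :=
  case: i => [[|[|[|[|]]]] //= ?]; case: j => [[|[|[|[|]]]] //= ?].

Section Mx4Computations.
Variable F : fieldType.

(** The right-hand side is a comprehension over rows and columns that [/=] unfolds into sixteen
    explicit entries, so identities between products become sixteen ring identities. *)
Lemma mx4_mul (a11 a12 a13 a14 a21 a22 a23 a24 a31 a32 a33 a34 a41 a42 a43 a44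
   b11 b12 b13 b14 b21 b22 b23 b24 b31 b32 b33 b34 b41 b42 b43 b44 : F) :
  mx4 [:: [:: a11; a12; a13; a14]; [:: a21; a22; a23; a24];
          [:: a31; a32; a33; a34]; [:: a41; a42; a43; a44]] *m
  mx4 [:: [:: b11; b12; b13; b14]; [:: b21; b22; b23; b24];
          [:: b31; b32; b33; b34]; [:: b41; b42; b43; b44]] =
  mx4 [seq [seq r.1 * c.1.1.1 + (r.2.1 * c.1.1.2 + (r.2.2.1 * c.1.2 + r.2.2.2 * c.2))
             | c <- [:: (b11, b21, b31, b41); (b12, b22, b32, b42);
                        (b13, b23, b33, b43); (b14, b24, b34, b44)]]
        | r <- [:: (a11, (a12, (a13, a14))); (a21, (a22, (a23, a24)));
                   (a31, (a32, (a33, a34))); (a41, (a42, (a43, a44)))]].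
Proof.
apply/matrixP=> i j; rewrite !mxE !big_ord_recl big_ord0 addr0 !mxE /=.
by mx4_cases i j.
Qed.

Lemma mx4_add (a11 a12 a13 a14 a21 a22 a23 a24 a31 a32 a33 a34 a41 a42 a43 a44
   b11 b12 b13 b14 b21 b22 b23 b24 b31 b32 b33 b34 b41 b42 b43 b44 : F) :
  mx4 [:: [:: a11; a12; a13; a14]; [:: a21; a22; a23; a24];
          [:: a31; a32; a33; a34]; [:: a41; a42; a43; a44]] +
  mx4 [:: [:: b11; b12; b13; b14]; [:: b21; b22; b23; b24];
          [:: b31; b32; b33; b34]; [:: b41; b42; b43; b44]] =
  mx4 [:: [:: a11 + b11; a12 + b12; a13 + b13; a14 + b14];
          [:: a21 + b21; a22 + b22; a23 + b23; a24 + b24];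
          [:: a31 + b31; a32 + b32; a33 + b33; a34 + b34];
          [:: a41 + b41; a42 + b42; a43 + b43; a44 + b44]].
Proof.
apply/matrixP=> i j; rewrite !mxE.
by mx4_cases i j.
Qed.

Lemma mx4_tr (a11 a12 a13 a14 a21 a22 a23 a24 a31 a32 a33 a34 a41 a42 a43 a44 : F) :
  (mx4 [:: [:: a11; a12; a13; a14]; [:: a21; a22; a23; a24];
          [:: a31; a32; a33; a34]; [:: a41; a42; a43; a44]])^T =
  mx4 [:: [:: a11; a21; a31; a41]; [:: a12; a22; a32; a42];
          [:: a13; a23; a33; a43]; [:: a14; a24; a34; a44]].
Proof.
apply/matrixP=> i j; rewrite !mxE.
by mx4_cases i j.
Qed.

Lemma JE : @J F = mx4 [:: [:: 0; 0; 1; 0]; [:: 0; 0; 0; 1]; [:: -1; 0; 0; 0]; [:: 0; -1; 0; 0]].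
Proof. by []. Qed.

Lemma bor_lin (c d a b p q r s a' b' p' q' r' s' : F) :
  c *: bor a b p q r s + d *: bor a' b' p' q' r' s' =
  bor (c * a + d * a') (c * b + d * b') (c * p + d * p') (c * q + d * q')
      (c * r + d * r') (c * s + d * s').
Proof.
apply/matrixP=> i j; rewrite !mxE.
by mx4_cases i j; ring.
Qed.

End Mx4Computations.

Ltac mx4_ring := rewrite /bor ?JE ?mx4_tr ?mx4_mul ?mx4_add /=;
  congr (mx4 [:: [:: _; _; _; _]; [:: _; _; _; _]; [:: _; _; _; _]; [:: _; _; _; _]]);
  ring.

(** * Brackets in the Borel subalgebra and the action of root subgroups *)

Section ConjugationInSp4.
Variable F : fieldType.

Lemma bor_in_sp4 (a b p q r s : F) : bor a b p q r s \in @sp4 F.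
Proof.
by rewrite inE; apply/eqP; mx4_ring.
Qed.

(** The factors 2b, a - b, a + b, 2a are the values at T_{a,b} of the roots alpha, beta, alpha+beta,
    alpha+2beta; the remaining terms come from brackets of root vectors. The torus part of the
    bracket is zero. *)
Lemma bor_comm (a b p q r s p' q' r' s' : F) :
  bor a b p q r s *m bor 0 0 p' q' r' s' - bor 0 0 p' q' r' s' *m bor a b p q r s =
  bor 0 0 (2 * b * p') ((a - b) * q') ((a + b) * r' + q * p' - p * q')
          (2 * a * s' + 2 * (q * r' - r * q')).
Proof. by apply/eqP; rewrite subr_eq; apply/eqP; mx4_ring. Qed.

(* Root subgroups: each X_gamma squares to zero, so exp(c X_gamma) = 1 + c X_gamma. *)
Definition u_alpha (c : F) : 'M[F]_4 :=
  mx4 [:: [:: 1; 0; 0; 0]; [:: 0; 1; 0; c]; [:: 0; 0; 1; 0]; [:: 0; 0; 0; 1]].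
Definition u_beta (c : F) : 'M[F]_4 :=
  mx4 [:: [:: 1; c; 0; 0]; [:: 0; 1; 0; 0]; [:: 0; 0; 1; 0]; [:: 0; 0; - c; 1]].
Definition u_alpha_beta (c : F) : 'M[F]_4 :=
  mx4 [:: [:: 1; 0; 0; c]; [:: 0; 1; c; 0]; [:: 0; 0; 1; 0]; [:: 0; 0; 0; 1]].
Definition u_alpha_2beta (c : F) : 'M[F]_4 :=
  mx4 [:: [:: 1; 0; c; 0]; [:: 0; 1; 0; 0]; [:: 0; 0; 1; 0]; [:: 0; 0; 0; 1]].

(** Here and below conjugation is stated as g X = X' g, so that no inverse is computed. The subgroup
    of a root gamma shifts the coefficient at gamma by -c gamma(T) and otherwise changes only
    coefficients at higher roots. *)
Lemma u_alphaE c (a b p q r s : F) :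
  u_alpha c *m bor a b p q r s =
  bor a b (p - 2 * b * c) q (r - c * q) s *m u_alpha c.
Proof. by rewrite /u_alpha; mx4_ring. Qed.

Lemma u_betaE c (a b p q r s : F) :
  u_beta c *m bor a b p q r s =
  bor a b p (q - c * (a - b)) (r + c * p) (s + 2 * c * r + c ^+ 2 * p) *m u_beta c.
Proof. by rewrite /u_beta; mx4_ring. Qed.

Lemma u_alpha_betaE c (a b p q r s : F) :
  u_alpha_beta c *m bor a b p q r s =
  bor a b p q (r - c * (a + b)) (s - 2 * c * q) *m u_alpha_beta c.
Proof. by rewrite /u_alpha_beta; mx4_ring. Qed.

Lemma u_alpha_2betaE c (a b p q r s : F) :
  u_alpha_2beta c *m bor a b p q r s =
  bor a b p q r (s - 2 * a * c) *m u_alpha_2beta c.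
Proof. by rewrite /u_alpha_2beta; mx4_ring. Qed.

Lemma bor_inj (a b p q r s a' b' p' q' r' s' : F) :
  bor a b p q r s = bor a' b' p' q' r' s' ->
  [/\ a = a', b = b', p = p' & [/\ q = q', r = r' & s = s']].
Proof.
move=> /matrixP E.
move: (E 0 0) (E 1 1) (E 1 3) (E 0 1) (E 0 3) (E 0 2).
by rewrite !mxE /= => -> -> -> -> -> ->.
Qed.

Lemma bor0 : bor 0 0 0 0 0 0 = 0 :> 'M[F]_4.
Proof.
apply/matrixP=> i j; rewrite !mxE.
by mx4_cases i j; rewrite ?oppr0.
Qed.

Lemma bor_Tmx (a b : F) : bor a b 0 0 0 0 = Tmx a b.
Proof.
apply/matrixP=> i j; rewrite !mxE.
by mx4_cases i j; rewrite ?oppr0.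
Qed.

Lemma mem_borelP (X : 'M[F]_4) :
  X \in borel F -> exists a b p q r s, X = bor a b p q r s.
Proof.
case/memv_addP=> _ /mem_cartanP[a [b ->]] [Y + ->].
rewrite !span_cons span_nil addv0.
case/memv_addP=> {Y} _ /vlineP[p ->] [_ /memv_addP[_ /vlineP[q ->] [_ /memv_addP[_ /vlineP[r ->]
  [_ /vlineP[s ->] ->] ->] ->]]].
exists a, b, p, q, r, s; apply/matrixP=> i j; rewrite !mxE.
by mx4_cases i j; ring.
Qed.

Lemma alg1E : alg1 F = <<[:: bor 1 1 0 1 0 0; bor 0 0 0 0 0 1]>>%VS.
Proof.
rewrite /alg1; congr (<<[:: _; _]>>%VS); apply/matrixP=> i j; rewrite !mxE.
all: by mx4_cases i j; ring.
Qed.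

Lemma alg2E : alg2 F = <<[:: bor 1 0 1 0 0 0; bor 0 0 0 0 1 0]>>%VS.
Proof.
rewrite /alg2; congr (<<[:: _; _]>>%VS); apply/matrixP=> i j; rewrite !mxE.
all: by mx4_cases i j; ring.
Qed.

Lemma alg3E : alg3 F = <<[:: bor 1 0 1 0 0 0; bor 0 0 0 0 0 1]>>%VS.
Proof.
rewrite /alg3; congr (<<[:: _; _]>>%VS); apply/matrixP=> i j; rewrite !mxE.
all: by mx4_cases i j; ring.
Qed.

(** * Spans of two vectors and their equivalence under the symplectic group *)

Lemma span2P {K : fieldType} {vT : vectType K} (x y v : vT) :
  reflect (exists s t, v = s *: x + t *: y) (v \in <<[:: x; y]>>%VS).
Proof.
rewrite span_cons span_seq1; apply: (iffP memv_addP).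
  by case=> _ /vlineP[s ->] [_ /vlineP[t ->] ->]; exists s, t.
by case=> s [t ->]; exists (s *: x); rewrite ?memvZ ?memv_line //;
  exists (t *: y); rewrite ?memvZ ?memv_line.
Qed.

Lemma JJ : @J F *m @J F = - 1%:M.
Proof.
have -> : - 1%:M = mx4 [:: [:: -1; 0; 0; 0]; [:: 0; -1; 0; 0];
                           [:: 0; 0; -1; 0]; [:: 0; 0; 0; -1]] :> 'M[F]_4.
  apply/matrixP=> i j; rewrite !mxE.
  by mx4_cases i j; rewrite ?oppr0.
by mx4_ring.
Qed.

(** Since J^2 = -1, the relation exhibits [J *m g^T *m - J] as a right inverse of g, so g is
    invertible. *)
Lemma mem_Sp4 (g : 'M[F]_4) : g *m @J F *m g^T = @J F -> g \in @Sp4 F.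
Proof.
move=> gJ; rewrite inE gJ eqxx andbT.
suff /mulmx1_unit[] : g *m (@J F *m g^T *m - @J F) = 1%:M by [].
by rewrite mulmxN mulmxN !mulmxA gJ JJ opprK.
Qed.

Lemma Sp4_unit (g : 'M[F]_4) : g \in @Sp4 F -> g \in unitmx.
Proof. by rewrite inE => /andP[]. Qed.

Lemma Sp4_mul (g h : 'M[F]_4) : g \in @Sp4 F -> h \in @Sp4 F -> g *m h \in @Sp4 F.
Proof.
rewrite !inE => /andP[_ /eqP gJ] /andP[_ /eqP hJ]; apply: mem_Sp4.
by rewrite trmx_mul !mulmxA -(mulmxA g h) -(mulmxA g _ (h^T)) hJ gJ.
Qed.

Lemma conjE (g X Y : 'M[F]_4) : g \in unitmx -> g *m X = Y *m g -> g *m X *m invmx g = Y.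
Proof. by move=> gU ->; rewrite mulmxK. Qed.

Lemma equivalent_span (g x y x' y' : 'M[F]_4) :
  g \in @Sp4 F -> g *m x = x' *m g -> g *m y = y' *m g ->
  equivalent <<[:: x; y]>>%VS <<[:: x'; y']>>%VS.
Proof.
move=> gS gx gy; have gU := Sp4_unit gS; exists g => // Y.
have E s t : g *m (s *: x + t *: y) *m invmx g = s *: x' + t *: y'.
  by apply: conjE => //; rewrite mulmxDr mulmxDl -!scalemxAr -!scalemxAl gx gy.
split; first by case/span2P=> s [t ->]; exists (s *: x + t *: y); [apply/span2P; exists s, t|].
by case=> _ /span2P[s [t ->]] ->; rewrite E; apply/span2P; exists s, t.
Qed.

Lemma equivalent_trans (U V W : {vspace 'M[F]_4}) :
  equivalent U V -> equivalent V W -> equivalent U W.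
Proof.
case=> g gS gV [h hS hW]; have gU := Sp4_unit gS; have hU := Sp4_unit hS.
have E X : h *m g *m X *m invmx (h *m g) = h *m (g *m X *m invmx g) *m invmx h.
  by apply: conjE; rewrite ?unitmx_mul ?gU ?hU // !mulmxA !mulmxKV.
exists (h *m g) => [|Y]; first exact: Sp4_mul.
split; first by case/hW=> _ /gV[X XU ->] ->; exists X.
by case=> X XU ->; rewrite E; apply/hW; exists (g *m X *m invmx g) => //; apply/gV; exists X.
Qed.

Lemma span2_eq {K : fieldType} {vT : vectType K} (x y x' y' : vT) :
  x \in <<[:: x'; y']>>%VS -> y \in <<[:: x'; y']>>%VS ->
  x' \in <<[:: x; y]>>%VS -> y' \in <<[:: x; y]>>%VS ->
  <<[:: x; y]>>%VS = <<[:: x'; y']>>%VS.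
Proof.
move=> h1 h2 h3 h4; apply/eqP; rewrite eqEsubv; apply/andP; split;
  by apply/span_subvP=> z; rewrite !inE => /orP[] /eqP ->.
Qed.

Lemma span2_scale {K : fieldType} {vT : vectType K} c d (x y : vT) :
  c != 0 -> d != 0 -> <<[:: c *: x; d *: y]>>%VS = <<[:: x; y]>>%VS.
Proof.
move=> c0 d0; apply: span2_eq; apply/span2P.
- by exists c, 0; rewrite scale0r addr0.
- by exists 0, d; rewrite scale0r add0r.
- by exists c^-1, 0; rewrite scale0r addr0 scalerA mulVf ?scale1r.
- by exists 0, d^-1; rewrite scale0r add0r scalerA mulVf ?scale1r.
Qed.

Lemma semisimple_conj (g X Y : 'M[F]_4) :
  g \in unitmx -> g *m X = Y *m g -> semisimple_mx Y -> semisimple_mx X.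
Proof.
move=> gU gX [P PU PY]; exists (P *m g); first by rewrite unitmx_mul PU gU.
by move: PY; rewrite /similar_to conjuMumx // [conjmx g X]conjumx // gX mulmxK.
Qed.

Definition anisotropic (V : {vspace 'M[F]_4}) : Prop :=
  forall X, X \in V -> semisimple_mx X -> X = 0.

Lemma equivalent_anisotropic (V W : {vspace 'M[F]_4}) :
  equivalent V W -> anisotropic V -> anisotropic W.
Proof.
case=> g gS gW aV Y /gW[X XV ->] ss.
rewrite (aV _ XV) ?mulmx0 ?mul0mx //;
  apply: (semisimple_conj (g := g) _ _ ss); first exact: Sp4_unit.
by rewrite mulmxKV // Sp4_unit.
Qed.

(** With no root vectors left the element is diagonal, hence semisimple, hence zero. Comparing
    nested pairs with 0 says that not all coefficients vanish. *)
Lemma anisotropic_bor (V : {vspace 'M[F]_4}) (a b p q r s : F) :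
  anisotropic V -> bor a b p q r s \in V -> (a, b) != 0 -> (p, (q, (r, s))) != 0.
Proof.
move=> aV XV; apply: contra_neq => -[p0 q0 r0 s0]; move: XV; rewrite p0 q0 r0 s0 => /aV.
rewrite bor_Tmx => /(_ (diagonalizable_diag _)).
by rewrite -bor_Tmx -bor0 => /bor_inj[-> ->].
Qed.

Lemma bracket_conj (g X Y X' Y' : 'M[F]_4) l :
  g \in unitmx -> g *m X = X' *m g -> g *m Y = Y' *m g ->
  X *m Y - Y *m X = l *: Y -> X' *m Y' - Y' *m X' = l *: Y'.
Proof.
move=> gU gX gY XY; rewrite -[LHS](mulmxK gU) -[RHS](mulmxK gU); congr (_ *m _).
rewrite mulmxBl -(mulmxA X') -gY -(mulmxA Y') -gX (mulmxA X') -gX (mulmxA Y') -gY.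
by rewrite -!mulmxA -mulmxBr XY -scalemxAr gY scalemxAl.
Qed.

(** * Unipotent reduction of an element of the Borel subalgebra *)

Definition borel_conj (g : 'M[F]_4) : Prop :=
  forall a b p q r s, exists p' q' r' s',
    g *m bor a b p q r s = bor a b p' q' r' s' *m g.

Lemma u_alpha_Sp4 c : u_alpha c \in @Sp4 F.
Proof. by apply: mem_Sp4; rewrite /u_alpha; mx4_ring. Qed.

Lemma u_beta_Sp4 c : u_beta c \in @Sp4 F.
Proof. by apply: mem_Sp4; rewrite /u_beta; mx4_ring. Qed.

Lemma u_alpha_beta_Sp4 c : u_alpha_beta c \in @Sp4 F.
Proof. by apply: mem_Sp4; rewrite /u_alpha_beta; mx4_ring. Qed.

Lemma u_alpha_2beta_Sp4 c : u_alpha_2beta c \in @Sp4 F.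
Proof. by apply: mem_Sp4; rewrite /u_alpha_2beta; mx4_ring. Qed.

Lemma mulmx_conj (g h X Y Z : 'M[F]_4) :
  g *m X = Y *m g -> h *m Y = Z *m h -> (h *m g) *m X = Z *m (h *m g).
Proof. by move=> gX hY; rewrite -mulmxA gX mulmxA hY mulmxA. Qed.

(** The rightmost factor acts first. The roots are taken by increasing height, so each factor leaves
    alone the coefficients treated before it. *)
Definition unip c1 c2 c3 c4 : 'M[F]_4 :=
  u_alpha_2beta c4 *m (u_alpha_beta c3 *m (u_beta c2 *m u_alpha c1)).

Lemma unip_Sp4 c1 c2 c3 c4 : unip c1 c2 c3 c4 \in @Sp4 F.
Proof. by rewrite !Sp4_mul ?u_alpha_Sp4 ?u_beta_Sp4 ?u_alpha_beta_Sp4 ?u_alpha_2beta_Sp4. Qed.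

Lemma unipE c1 c2 c3 c4 (a b p q r s : F) :
  let p1 := p - 2 * b * c1 in let r1 := r - c1 * q in
  let q2 := q - c2 * (a - b) in let r2 := r1 + c2 * p1 in
  let s2 := s + 2 * c2 * r1 + c2 ^+ 2 * p1 in
  let r3 := r2 - c3 * (a + b) in let s3 := s2 - 2 * c3 * q2 in
  unip c1 c2 c3 c4 *m bor a b p q r s =
  bor a b p1 q2 r3 (s3 - 2 * a * c4) *m unip c1 c2 c3 c4.
Proof.
move=> *; apply: mulmx_conj; last exact: u_alpha_2betaE.
apply: mulmx_conj (u_alpha_betaE _ _ _ _ _ _ _).
by apply: mulmx_conj (u_alphaE _ _ _ _ _ _ _) (u_betaE _ _ _ _ _ _ _).
Qed.

Lemma unip_borel c1 c2 c3 c4 : borel_conj (unip c1 c2 c3 c4).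
Proof. by move=> a b p q r s; do 4 eexists; exact: unipE. Qed.

(** The coefficient at a root is cleared when the root does not vanish at T; the four products say
    that the surviving root vectors commute with T. The conjunct [borel_conj g] allows a second
    basis vector to be carried along with its torus part unchanged. *)
Lemma borel_reduce (a b p q r s : F) : (2 : F) != 0 ->
  exists2 g, g \in @Sp4 F & borel_conj g /\ exists p' q' r' s',
    g *m bor a b p q r s = bor a b p' q' r' s' *m g /\
    [/\ b * p' = 0, (a - b) * q' = 0, (a + b) * r' = 0 & a * s' = 0].
Proof.
move=> n2.
(* Also true for c = 0, because x / 0 = 0. *)
have killP (c x : F) : c * (x - c * (x / c)) = 0.
  have [->|c0] := eqVneq c 0; first by rewrite mul0r.
  by rewrite [c * (x / c)]mulrC divfK // subrr mulr0.
have halfK (c y : F) : 2 * c * (y / 2) = c * y by field.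
(* Each constant solves the linear equation that makes one coefficient vanish, computed from the
   coefficients left by the earlier factors. *)
pose c1 := p / b / 2; pose p1 := p - 2 * b * c1.
have Hp : b * p1 = 0.
  by rewrite /p1 /c1 halfK killP.
pose r1 := r - c1 * q.
pose c2 := q / (a - b); pose q2 := q - c2 * (a - b).
have Hq : (a - b) * q2 = 0 by rewrite /q2 /c2 mulrC -(killP (a - b) q); ring.
pose r2 := r1 + c2 * p1; pose s2 := s + 2 * c2 * r1 + c2 ^+ 2 * p1.
pose c3 := r2 / (a + b); pose r3 := r2 - c3 * (a + b).
have Hr : (a + b) * r3 = 0 by rewrite /r3 /c3 mulrC -(killP (a + b) r2); ring.
pose s3 := s2 - 2 * c3 * q2.
pose c4 := s3 / a / 2; pose s4 := s3 - 2 * a * c4.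
have Hs : a * s4 = 0.
  by rewrite /s4 /c4 halfK killP.
exists (unip c1 c2 c3 c4); first exact: unip_Sp4.
split; first exact: unip_borel.
exists p1, q2, r3, s4; split=> //.
exact: unipE.
Qed.

End ConjugationInSp4.

(** * Rescaling to the three models by the diagonal torus *)

Section Classification.
Variable F : numClosedFieldType.
Implicit Types (a b k m p q r s : F) (V : {vspace 'M[F]_4}).

Lemma equivalent_span_scale (g x y x' y' : 'M[F]_4) (c d : F) :
  g \in @Sp4 F -> c != 0 -> d != 0 ->
  g *m x = (c *: x') *m g -> g *m y = (d *: y') *m g ->
  equivalent <<[:: x; y]>>%VS <<[:: x'; y']>>%VS.
Proof.
move=> gS c0 d0 gx gy; rewrite -(span2_scale x' y' c0 d0).
exact: equivalent_span gx gy.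
Qed.

Lemma bor_scale c a b p q r s :
  c *: bor a b p q r s = bor (c * a) (c * b) (c * p) (c * q) (c * r) (c * s).
Proof.
by rewrite -[LHS]addr0 -(scale0r (bor 0 0 0 0 0 0)) bor_lin; congr bor; ring.
Qed.

Definition torus (t u : F) : 'M[F]_4 :=
  mx4 [:: [:: t; 0; 0; 0]; [:: 0; u; 0; 0]; [:: 0; 0; t^-1; 0]; [:: 0; 0; 0; u^-1]].

Ltac mx4_field := rewrite ?bor_scale /bor ?JE ?mx4_tr ?mx4_mul ?mx4_add /=;
  congr (mx4 [:: [:: _; _; _; _];  [:: _; _; _; _]; [:: _; _; _; _]; [:: _; _; _; _]]);
  try ring; try field.

Lemma torus_Sp4 t u : t != 0 -> u != 0 -> torus t u \in @Sp4 F.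
Proof. by move=> t0 u0; apply: mem_Sp4; rewrite /torus; mx4_field. Qed.

Lemma torusE t u a b p q r s : t != 0 -> u != 0 ->
  torus t u *m bor a b p q r s =
  bor a b (u ^+ 2 * p) (t / u * q) (t * u * r) (t ^+ 2 * s) *m torus t u.
Proof. by move=> t0 u0; rewrite /torus; mx4_field; rewrite ?t0 ?u0. Qed.

Lemma equivalent_alg1 a k m : a != 0 -> k != 0 -> m != 0 ->
  equivalent <<[:: bor a a 0 k 0 0; bor 0 0 0 0 0 m]>>%VS (alg1 F).
Proof.
move=> a0 k0 m0; rewrite alg1E; have t0 : a / k != 0 by rewrite mulf_neq0 ?invr_neq0.
(* The root beta takes the value a / k on this torus element, so k becomes a and the first vector
   becomes a times its model. *)
apply: (@equivalent_span_scale (torus (a / k) 1) _ _ _ _ a ((a / k) ^+ 2 * m)).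
- by rewrite torus_Sp4 ?oner_eq0.
- by [].
- by rewrite mulf_neq0 ?expf_neq0.
- by rewrite torusE ?oner_eq0 // bor_scale; congr (bor _ _ _ _ _ _ *m _); field.
- by rewrite torusE ?oner_eq0 // bor_scale; congr (bor _ _ _ _ _ _ *m _); ring.
Qed.

Lemma exists_sqrt (x : F) : x != 0 -> exists2 t, t != 0 & t ^+ 2 = x.
Proof. by move=> x0; exists (sqrtC x); rewrite ?sqrtC_eq0 ?sqrtCK. Qed.

(** The root alpha is a square on the torus, so turning the coefficient p into a takes a square root
    of a / p; here algebraic closedness enters. *)
Lemma equivalent_alg2 a p m : a != 0 -> p != 0 -> m != 0 ->
  equivalent <<[:: bor a 0 p 0 0 0; bor 0 0 0 0 m 0]>>%VS (alg2 F).
Proof.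
move=> a0 p0 m0; rewrite alg2E.
have [t t0 tE] : exists2 t, t != 0 & t ^+ 2 = a / p.
  by apply: exists_sqrt; rewrite mulf_neq0 ?invr_neq0.
apply: (@equivalent_span_scale (torus 1 t) _ _ _ _ a (t * m)).
- by rewrite torus_Sp4 ?oner_eq0.
- by [].
- by rewrite mulf_neq0.
- by rewrite torusE ?oner_eq0 // tE bor_scale; congr (bor _ _ _ _ _ _ *m _); field.
- by rewrite torusE ?oner_eq0 // bor_scale; congr (bor _ _ _ _ _ _ *m _); ring.
Qed.

Lemma equivalent_alg3 a p m : a != 0 -> p != 0 -> m != 0 ->
  equivalent <<[:: bor a 0 p 0 0 0; bor 0 0 0 0 0 m]>>%VS (alg3 F).
Proof.
move=> a0 p0 m0; rewrite alg3E.
have [t t0 tE] : exists2 t, t != 0 & t ^+ 2 = a / p.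
  by apply: exists_sqrt; rewrite mulf_neq0 ?invr_neq0.
apply: (@equivalent_span_scale (torus 1 t) _ _ _ _ a m).
- by rewrite torus_Sp4 ?oner_eq0.
- by [].
- by [].
- by rewrite torusE ?oner_eq0 // tE bor_scale; congr (bor _ _ _ _ _ _ *m _); field.
- by rewrite torusE ?oner_eq0 // bor_scale; congr (bor _ _ _ _ _ _ *m _); ring.
Qed.

(** * Weyl group representatives *)

Definition weyl_alpha : 'M[F]_4 :=
  mx4 [:: [:: 1; 0; 0; 0]; [:: 0; 0; 0; 1]; [:: 0; 0; 1; 0]; [:: 0; -1; 0; 0]].
Definition weyl_beta : 'M[F]_4 :=
  mx4 [:: [:: 0; 1; 0; 0]; [:: 1; 0; 0; 0]; [:: 0; 0; 0; 1]; [:: 0; 0; 1; 0]].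

Lemma weyl_alpha_Sp4 : weyl_alpha \in @Sp4 F.
Proof. by apply: mem_Sp4; rewrite /weyl_alpha; mx4_ring. Qed.

Lemma weyl_beta_Sp4 : weyl_beta \in @Sp4 F.
Proof. by apply: mem_Sp4; rewrite /weyl_beta; mx4_ring. Qed.

(** In this and the next relations, root coefficients are set to zero at the positive roots that the
    Weyl element makes negative, so that the image stays in the Borel subalgebra. *)
Lemma weyl_alphaE a b q r s :
  weyl_alpha *m bor a b 0 q r s = bor a (- b) 0 r (- q) s *m weyl_alpha.
Proof. by rewrite /weyl_alpha; mx4_ring. Qed.

Lemma weyl_betaE a b p r s :
  weyl_beta *m bor a b p 0 r s = bor b a s 0 r p *m weyl_beta.
Proof. by rewrite /weyl_beta; mx4_ring. Qed.

(** These two represent the rotations of order four in the Weyl group, (a,b) to (-b,a) and (a,b) to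
    (b,-a). *)
Definition weyl_neg_beta : 'M[F]_4 :=
  mx4 [:: [:: 0; 0; 0; 1]; [:: 1; 0; 0; 0]; [:: 0; -1; 0; 0]; [:: 0; 0; 1; 0]].
Definition weyl_neg_alpha : 'M[F]_4 :=
  mx4 [:: [:: 0; 1; 0; 0]; [:: 0; 0; 1; 0]; [:: 0; 0; 0; 1]; [:: -1; 0; 0; 0]].

Lemma weyl_neg_beta_Sp4 : weyl_neg_beta \in @Sp4 F.
Proof. by apply: mem_Sp4; rewrite /weyl_neg_beta; mx4_ring. Qed.

Lemma weyl_neg_alpha_Sp4 : weyl_neg_alpha \in @Sp4 F.
Proof. by apply: mem_Sp4; rewrite /weyl_neg_alpha; mx4_ring. Qed.

Lemma weyl_neg_betaE b q s :
  weyl_neg_beta *m bor 0 b 0 q 0 s = bor (- b) 0 s 0 (- q) 0 *m weyl_neg_beta.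
Proof. by rewrite /weyl_neg_beta; mx4_ring. Qed.

Lemma weyl_neg_alphaE a b p r :
  weyl_neg_alpha *m bor a b p 0 r 0 = bor b (- a) 0 r 0 p *m weyl_neg_alpha.
Proof. by rewrite /weyl_neg_alpha; mx4_ring. Qed.

(** * Solving the eigenvector equation [x, y] = l y *)

Lemma eigenvalue_coef (c l m : F) : c * m = l * m -> m != 0 -> l = c.
Proof. by move=> E m0; apply/esym/(mulIf m0). Qed.

(** Characteristic zero is used. The multiplier is n + 1, so [eq0_natmul 1] cancels a factor 2. *)
Lemma eq0_natmul (n : nat) (a x : F) : n.+1%:R * a * x = 0 -> a != 0 -> x = 0.
Proof. by move=> /eqP; rewrite !mulf_eq0 pnatr_eq0 /= => + a0; rewrite (negPf a0) => /eqP. Qed.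

Definition equivalent_to_model V : Prop :=
  [\/ equivalent V (alg1 F), equivalent V (alg2 F) | equivalent V (alg3 F)].

Lemma equivalent_to_model_trans U V :
  equivalent U V -> equivalent_to_model V -> equivalent_to_model U.
Proof.
by move=> UV [] /(equivalent_trans UV);
  [constructor 1 | constructor 2 | constructor 3].
Qed.

(** The element x + k y is nonzero with torus part T_{a,b}, hence not diagonal. The value k = 0
    concerns x itself; other values are chosen to cancel a root coefficient of x. *)
Lemma anisotropic_span (a b p q r s k m1 m2 m3 m4 : F) :
  anisotropic <<[:: bor a b p q r s; bor 0 0 m1 m2 m3 m4]>>%VS -> (a, b) != 0 ->
  (p + k * m1, (q + k * m2, (r + k * m3, s + k * m4))) != 0.
Proof.
move=> aV; apply: (anisotropic_bor aV).
by apply/span2P; exists 1, k; rewrite bor_lin; congr bor; ring.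
Qed.

Lemma pair_neq0 (U W : nmodType) (a : U) (b : W) : (a, b) != 0 = (a != 0) || (b != 0).
Proof. by rewrite -negb_and. Qed.

(** The torus part T_{a,a} has weight 0 on X_beta and 2a on the other root vectors. If y had an
    X_beta component, then l = 0, y would be a multiple of X_beta, and x - (q/m2) y would be
    diagonal. On the rest, X_beta acts as a nilpotent chain from X_alpha through X_{alpha+beta} to
    X_{alpha+2beta}, whose only eigenline is the last. *)
Lemma classify_beta (a q l m1 m2 m3 m4 : F) :
  let V := <<[:: bor a a 0 q 0 0; bor 0 0 m1 m2 m3 m4]>>%VS in
  anisotropic V -> a != 0 -> (m1, (m2, (m3, m4))) != 0 ->
  [/\ 2 * a * m1 = l * m1, 0 = l * m2, 2 * a * m3 + q * m1 = l * m3
    & 2 * a * m4 + 2 * q * m3 = l * m4] ->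
  equivalent V (alg1 F).
Proof.
move=> V aV a0 M0 [E1 E2 E3 E4].
have q0 : q != 0.
  have /(_ 0) := anisotropic_span _ aV.
  rewrite !mul0r !addr0 !pair_neq0 a0 eqxx /= orbF => -> //.
have m20 : m2 = 0.
  have [//|m2n] := eqVneq m2 0.
  have l0 : l = 0 by apply: (mulIf m2n); rewrite -E2 mul0r.
  have m10 : m1 = 0 by apply: (@eq0_natmul 1 a) => //; rewrite E1 l0 mul0r.
  have m30 : m3 = 0.
    by apply: (@eq0_natmul 1 a) => //; rewrite -(mul0r m3) -l0 -E3 m10 mulr0 addr0.
  have m40 : m4 = 0.
    by apply: (@eq0_natmul 1 a) => //; rewrite -(mul0r m4) -l0 -E4 m30 mulr0 addr0.
  have /(_ (- q / m2)) := anisotropic_span _ aV.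
  by rewrite m10 m30 m40 divfK // subrr !mulr0 !addr0 !pair_neq0 a0 eqxx => /(_ isT).
have m10 : m1 = 0.
  have [//|m1n] := eqVneq m1 0.
  have E := eigenvalue_coef E1 m1n.
  move: E3; rewrite E => /eqP; rewrite -subr_eq0 addrAC subrr add0r mulf_eq0 (negPf q0).
  by move/eqP.
have m30 : m3 = 0.
  have [//|m3n] := eqVneq m3 0.
  have E : l = 2 * a by apply: eigenvalue_coef m3n; rewrite -E3 m10 mulr0 addr0.
  apply: (@eq0_natmul 1 q) => //; apply: (addrI (2 * a * m4)).
  by rewrite E4 E addr0.
rewrite /V m10 m20 m30; apply: equivalent_alg1 => //.
by move: M0; rewrite m10 m20 m30 !pair_neq0 eqxx.
Qed.

(** The torus part T_{a,0} has weights 0, a, a, 2a. Weight 0 is excluded because x - (p/m1) y would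
    be diagonal. In weight a, X_alpha sends X_beta to a multiple of X_{alpha+beta}, leaving only the
    line of X_{alpha+beta} (second model); weight 2a gives X_{alpha+2beta} (third model). *)
Lemma classify_alpha (a p l m1 m2 m3 m4 : F) :
  let V := <<[:: bor a 0 p 0 0 0; bor 0 0 m1 m2 m3 m4]>>%VS in
  anisotropic V -> a != 0 -> (m1, (m2, (m3, m4))) != 0 ->
  [/\ 0 = l * m1, a * m2 = l * m2, a * m3 - p * m2 = l * m3
    & 2 * a * m4 = l * m4] ->
  equivalent_to_model V.
Proof.
move=> V aV a0 M0 [E1 E2 E3 E4].
have p0 : p != 0.
  have /(_ 0) := anisotropic_span _ aV.
  rewrite !mul0r !addr0 !pair_neq0 a0 eqxx /= orbF => -> //.
have m10 : m1 = 0.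
  have [//|m1n] := eqVneq m1 0.
  have l0 : l = 0 by apply: (mulIf m1n); rewrite -E1 mul0r.
  have m20 : m2 = 0 by apply: (mulfI a0); rewrite E2 l0 mul0r mulr0.
  have m30 : m3 = 0.
    by apply: (mulfI a0); rewrite mulr0 -(mul0r m3) -l0 -E3 m20 mulr0 subr0.
  have m40 : m4 = 0 by apply: (@eq0_natmul 1 a) => //; rewrite E4 l0 mul0r.
  have /(_ (- p / m1)) := anisotropic_span _ aV.
  by rewrite m20 m30 m40 divfK // subrr !mulr0 !addr0 !pair_neq0 a0 eqxx => /(_ isT).
have m20 : m2 = 0.
  have [//|m2n] := eqVneq m2 0.
  have E := eigenvalue_coef E2 m2n.
  apply: (mulfI p0); apply: oppr_inj; apply: (addrI (a * m3)).
  by rewrite E3 E mulr0 oppr0 addr0.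
rewrite /V m10 m20 in M0 *; clear V aV.
have [m30|m3n] := eqVneq m3 0.
  constructor 3; rewrite m30; apply: equivalent_alg3 => //.
  by move: M0; rewrite m30 !pair_neq0 eqxx.
constructor 2; suff -> : m4 = 0 by exact: equivalent_alg2.
have E : l = a by apply: eigenvalue_coef m3n; rewrite -E3 m20 mulr0 subr0.
by apply: (@eq0_natmul 0 a) => //; apply: (addIr (a * m4)); rewrite -{3}E -E4; ring.
Qed.

(** The cases are the positive root that vanishes at T. A simple reflection brings alpha+2beta to
    alpha, and alpha+beta to beta, provided y has no component at the simple root being reversed.
    Otherwise that component determines l, y is a multiple of that simple root vector, and a
    rotation of order four is used instead. *)
Lemma classify_pair (a b p q r s l m1 m2 m3 m4 : F) :
  let x := bor a b p q r s in let y := bor 0 0 m1 m2 m3 m4 in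
  let V := <<[:: x; y]>>%VS in
  anisotropic V -> (a, b) != 0 -> (m1, (m2, (m3, m4))) != 0 ->
  x *m y - y *m x = l *: y ->
  [/\ b * p = 0, (a - b) * q = 0, (a + b) * r = 0 & a * s = 0] ->
  equivalent_to_model V.
Proof.
move=> x y V aV ab0 M0 + [Hp Hq Hr Hs].
rewrite bor_comm bor_scale => /bor_inj[_ _ E1 [E2 E3 E4]].
have kill (c t : F) : c * t = 0 -> c != 0 -> t = 0.
  by move=> /eqP + c0; rewrite mulf_eq0 (negPf c0) => /eqP.
have [b0|bn] := eqVneq b 0.
  have an : a != 0 by move: ab0; rewrite b0 pair_neq0 eqxx orbF.
  have q0 : q = 0 by apply: (kill a) => //; rewrite -Hq b0 subr0.
  have r0 : r = 0 by apply: (kill a) => //; rewrite -Hr b0 addr0.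
  have s0 := kill _ _ Hs an.
  move: aV; rewrite /V /x b0 q0 r0 s0 => aV; apply: (classify_alpha (l := l)) => //.
  by split; rewrite -?E1 -?E2 -?E3 -?E4 ?b0 ?q0 ?r0; ring.
have p0 := kill _ _ Hp bn.
(* The root alpha+2beta vanishes at T. *)
have [a0|an] := eqVneq a 0.
  have q0 : q = 0 by move: Hq; rewrite a0 sub0r => /kill; apply; rewrite oppr_eq0.
  have r0 : r = 0 by apply: (kill b) => //; rewrite -Hr a0 add0r.
  rewrite a0 q0 p0 r0 !(mul0r, add0r, subr0, addr0, mulr0) in E1 E2 E3 E4.
  have [m20|m2n] := eqVneq m2 0.
    have Vw : equivalent V <<[:: bor b 0 s 0 0 0; bor 0 0 m4 0 m3 m1]>>%VS.
      apply: (equivalent_span (g := weyl_beta)); first exact: weyl_beta_Sp4.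
        by rewrite /x p0 q0 r0 a0 weyl_betaE.
      by rewrite /y m20 weyl_betaE.
    apply: (equivalent_to_model_trans Vw).
    apply: (classify_alpha (l := l)) => //; first exact: equivalent_anisotropic Vw aV.
      by move: M0; rewrite m20 !pair_neq0 eqxx /= => /or3P[] ->; rewrite ?orbT.
    by split; rewrite -?E1 -?E3 -?E4 ?mulr0 ?subr0.
  (* The weight -b of X_beta differs from the weights 2b, b, 0 of the other root vectors, so only m2
     survives. *)
  have lE : l = - b by apply: eigenvalue_coef m2n.
  have m10 : m1 = 0.
    by apply: (@eq0_natmul 2 b) => //; rewrite -(subrr (l * m1)) -{1}E1 lE; ring.
  have m30 : m3 = 0.
    by apply: (@eq0_natmul 1 b) => //; rewrite -(subrr (l * m3)) -{1}E3 lE; ring.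
  have m40 : m4 = 0.
    by apply: (@eq0_natmul 0 b) => //; rewrite -(subrr (l * m4)) -{1}E4 lE; ring.
  have sn : s != 0.
    have /(_ 0) := anisotropic_span _ aV ab0.
    by rewrite !mul0r !addr0 p0 q0 r0 !pair_neq0 eqxx.
  suff Vw : equivalent V <<[:: bor (- b) 0 s 0 0 0; bor 0 0 0 0 (- m2) 0]>>%VS.
    constructor 2; apply: equivalent_trans Vw _.
    by apply: equivalent_alg2; rewrite ?oppr_eq0.
  apply: (equivalent_span (g := weyl_neg_beta)); first exact: weyl_neg_beta_Sp4.
    by rewrite /x p0 q0 r0 a0 weyl_neg_betaE oppr0.
  by rewrite /y m10 m30 m40 weyl_neg_betaE oppr0.
have s0 := kill _ _ Hs an.
have [abE|abn] := eqVneq a b.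
  have r0 : r = 0 by apply: (@eq0_natmul 1 a) => //; rewrite -Hr -abE; ring.
  constructor 1; move: aV; rewrite /V /x p0 r0 s0 -abE => aV.
  apply: (classify_beta (l := l)) => //.
  by split; rewrite -?E1 -?E2 -?E3 -?E4 -?abE ?p0 ?r0; ring.
have q0 : q = 0 by apply: (kill (a - b)) => //; rewrite subr_eq0.
have [abE|abN] := eqVneq b (- a); last first.
  (* No positive root vanishes at T, so x would be diagonal. *)
  have r0 : r = 0 by apply: (kill (a + b)) => //; rewrite addrC addr_eq0.
  have /(_ 0) := anisotropic_span _ aV ab0.
  by rewrite !mul0r !addr0 p0 q0 r0 s0 eqxx.
constructor 1; rewrite abE p0 q0 in E1 E2 E3 E4.
have [m10|m1n] := eqVneq m1 0.
  have Vw : equivalent V <<[:: bor a a 0 r 0 0; bor 0 0 0 m3 (- m2) m4]>>%VS.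
    apply: (equivalent_span (g := weyl_alpha)); first exact: weyl_alpha_Sp4.
      by rewrite /x p0 q0 s0 abE weyl_alphaE opprK oppr0.
    by rewrite /y m10 weyl_alphaE oppr0.
  apply: (equivalent_trans Vw).
  apply: (classify_beta (l := l)) => //; first exact: equivalent_anisotropic Vw aV.
    by move: M0; rewrite m10 !pair_neq0 eqxx oppr_eq0 /= => /or3P[] ->; rewrite ?orbT.
  by split; rewrite ?mulrN -?E1 -?E2 -?E3 -?E4 ?m10; ring.
(* The weight -2a of X_alpha differs from the weights 2a, 0, 2a of the other root vectors, so only
   m1 survives. *)
have lE : l = 2 * - a by apply: eigenvalue_coef m1n.
have m20 : m2 = 0.
  by apply: (@eq0_natmul 3 a) => //; rewrite -(subrr (l * m2)) -{1}E2 lE; ring.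
have m30 : m3 = 0.
  by apply: (@eq0_natmul 1 a) => //; rewrite -(subrr (l * m3)) -{1}E3 lE m20; ring.
have m40 : m4 = 0.
  by apply: (@eq0_natmul 3 a) => //; rewrite -(subrr (l * m4)) -{1}E4 lE m20; ring.
have rn : r != 0.
  have /(_ 0) := anisotropic_span _ aV ab0.
  by rewrite !mul0r !addr0 p0 q0 s0 !pair_neq0 eqxx orbF.
suff Vw : equivalent V <<[:: bor (- a) (- a) 0 r 0 0; bor 0 0 0 0 0 m1]>>%VS.
  apply: equivalent_trans Vw _.
  by apply: equivalent_alg1; rewrite ?oppr_eq0.
apply: (equivalent_span (g := weyl_neg_alpha)); first exact: weyl_neg_alpha_Sp4.
  by rewrite /x p0 q0 s0 abE weyl_neg_alphaE.
by rewrite /y m20 m30 m40 weyl_neg_alphaE oppr0.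
Qed.

(** * Choice of a basis with one strictly triangular vector *)

Lemma bor_nilpotent p q r s : nilpotent_mx (bor 0 0 p q r s).
Proof.
(* The exponent 4 is written as 2 * 2 so that only squarings are computed. *)
exists (2 * 2)%N; rewrite exprM !expr2 -bor0.
by rewrite -![_ * _]/(_ *m _); mx4_ring.
Qed.

Lemma two_neq0 : (2 : F) != 0. Proof. by rewrite pnatr_eq0. Qed.

(** Independent torus parts would put into V an element with torus part T_{1,2}, where the roots
    take the nonzero values 4, -1, 3, 2. It is then conjugate to a diagonal matrix, hence
    semisimple, hence zero. *)
Lemma singular_torus_part V (a1 b1 p1 q1 r1 s1 a2 b2 p2 q2 r2 s2 : F) :
  anisotropic V -> bor a1 b1 p1 q1 r1 s1 \in V -> bor a2 b2 p2 q2 r2 s2 \in V ->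
  a1 * b2 = a2 * b1.
Proof.
move=> aV V1 V2; apply/eqP; rewrite -subr_eq0; apply/negP=> /negP d0.
set d := _ - _ in d0.
(* Cramer's rule for u a1 + v a2 = 1 and u b1 + v b2 = 2. *)
pose u := (b2 - 2 * a2) / d; pose v := (2 * a1 - b1) / d.
have [p [q [r [s XV]]]] : exists p q r s, bor 1 2 p q r s \in V.
  exists (u * p1 + v * p2), (u * q1 + v * q2), (u * r1 + v * r2), (u * s1 + v * s2).
  suff <- : u *: bor a1 b1 p1 q1 r1 s1 + v *: bor a2 b2 p2 q2 r2 s2 =
      bor 1 2 (u * p1 + v * p2) (u * q1 + v * q2) (u * r1 + v * r2) (u * s1 + v * s2).
    by apply: memvD; apply: memvZ.
  by rewrite bor_lin; congr bor; rewrite /u /v /d; field.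
have [g gS [_ [p' [q' [r' [s' [gX [E1 E2 E3 E4]]]]]]]] :=
  borel_reduce 1 2 p q r s two_neq0.
have p0 : p' = 0 by apply: (mulfI two_neq0); rewrite mulr0.
have q0 : q' = 0 by apply/eqP; rewrite -oppr_eq0 -E2; apply/eqP; ring.
have r0 : r' = 0 by apply: (@eq0_natmul 2 1); rewrite ?oner_eq0 // -E3; ring.
have s0 : s' = 0 by rewrite -E4 mul1r.
rewrite p0 q0 r0 s0 in gX; have gU := Sp4_unit gS.
have /bor_inj[/eqP] : bor 1 2 p q r s = bor 0 0 0 0 0 0.
  rewrite bor0; apply: aV => //; apply: (semisimple_conj gU gX).
  by rewrite bor_Tmx; apply: diagonalizable_diag.
by rewrite oner_eq0.
Qed.

Lemma anisotropic_basis V (a1 b1 p1 q1 r1 s1 a2 b2 p2 q2 r2 s2 : F) :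
  anisotropic V -> V = <<[:: bor a1 b1 p1 q1 r1 s1; bor a2 b2 p2 q2 r2 s2]>>%VS ->
  (a1, b1) != 0 ->
  exists p q r s, V = <<[:: bor a1 b1 p1 q1 r1 s1; bor 0 0 p q r s]>>%VS.
Proof.
move=> aV VE ab0.
have E : a1 * b2 = a2 * b1.
  apply: (singular_torus_part (p1 := p1) (q1 := q1) (r1 := r1) (s1 := s1)
    (p2 := p2) (q2 := q2) (r2 := r2) (s2 := s2) aV);
    rewrite VE; apply/span2P.
    by exists 1, 0; rewrite scale1r scale0r addr0.
  by exists 0, 1; rewrite scale1r scale0r add0r.
(* The torus parts are proportional, so k is found from a nonzero coordinate of the first. *)
have [k ka kb] : exists2 k, k * a1 + a2 = 0 & k * b1 + b2 = 0.
  move: ab0; rewrite pair_neq0; have [a0|an _] := eqVneq a1 0; last first.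
    exists (- a2 / a1); first by field.
    by apply: (mulfI an); rewrite mulrDr E; field.
  move=> /= bn; exists (- b2 / b1); last by field.
  by apply: (mulIf bn); rewrite mulrDl -E a0; ring.
exists (k * p1 + p2), (k * q1 + q2), (k * r1 + r2), (k * s1 + s2).
set x := bor a1 _ _ _ _ _ in VE *; set y := bor a2 _ _ _ _ _ in VE.
have -> : bor 0 0 (k * p1 + p2) (k * q1 + q2) (k * r1 + r2) (k * s1 + s2) = k *: x + y.
  by rewrite -[y]scale1r bor_lin !mul1r ka kb.
rewrite VE; apply: span2_eq; apply/span2P.
- by exists 1, 0; rewrite scale1r scale0r addr0.
- by exists (- k), 1; rewrite scale1r scaleNr addKr.
- by exists 1, 0; rewrite scale1r scale0r addr0.
- by exists k, 1; rewrite scale1r.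
Qed.

Lemma borel_basis V :
  (V <= borel F)%VS -> \dim V = 2%N -> anisotropic V ->
  ~ (forall X, X \in V -> nilpotent_mx X) ->
  exists a b p q r s m1 m2 m3 m4,
    [/\ V = <<[:: bor a b p q r s; bor 0 0 m1 m2 m3 m4]>>%VS,
        (a, b) != 0 & (m1, (m2, (m3, m4))) != 0].
Proof.
move=> VB dV aV nnil.
have [x [y VE]] : exists x y, V = <<[:: x; y]>>%VS.
  have := span_basis (vbasisP V); have : size (vbasis V) = 2%N by rewrite size_tuple.
  by case: (tval _) => [|x [|y []]] //= _ VE; exists x, y.
have [a1 [b1 [p1 [q1 [r1 [s1 xE]]]]]] : exists a b p q r s, x = bor a b p q r s.
  apply: mem_borelP; apply: (subvP VB); rewrite VE; apply/span2P.
  by exists 1, 0; rewrite scale1r scale0r addr0.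
have [a2 [b2 [p2 [q2 [r2 [s2 yE]]]]]] : exists a b p q r s, y = bor a b p q r s.
  apply: mem_borelP; apply: (subvP VB); rewrite VE; apply/span2P.
  by exists 0, 1; rewrite scale1r scale0r add0r.
have nz a b p q r s (m1 m2 m3 m4 : F) :
    V = <<[:: bor a b p q r s; bor 0 0 m1 m2 m3 m4]>>%VS -> (m1, (m2, (m3, m4))) != 0.
  move=> E; apply/eqP=> -[m10 m20 m30 m40]; move: dV.
  rewrite E m10 m20 m30 m40 bor0 span_cons span_seq1 (addv_idPl _) -?memvE ?mem0v // => d.
  by have := dim_vline (bor a b p q r s); rewrite d; case: eqP.
rewrite xE yE in VE.
have [ab0|] := eqVneq (a1, b1) 0; last first.
  move=> ab0; have [p [q [r [s E]]]] := anisotropic_basis aV VE ab0.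
  by exists a1, b1, p1, q1, r1, s1, p, q, r, s; split=> //; apply: nz E.
have [ab0'|] := eqVneq (a2, b2) 0; last first.
  have VE' : V = <<[:: bor a2 b2 p2 q2 r2 s2; bor a1 b1 p1 q1 r1 s1]>>%VS.
    by rewrite VE !span_cons span_nil !addv0 addvC.
  move=> ab0'; have [p [q [r [s E]]]] := anisotropic_basis aV VE' ab0'.
  by exists a2, b2, p2, q2, r2, s2, p, q, r, s; split=> //; apply: nz E.
case: nnil => X; rewrite VE => /span2P[u [v ->]].
case: ab0 ab0' => -> -> [-> ->]; rewrite bor_lin !mulr0 addr0.
exact: bor_nilpotent.
Qed.

Lemma classify V :
  is_subalgebra V -> (V <= borel F)%VS -> \dim V = 2%N -> anisotropic V ->
  ~ (forall X, X \in V -> nilpotent_mx X) -> equivalent_to_model V.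
Proof.
move=> [_ sV] VB dV aV nnil.
have [a [b [p [q [r [s [m1 [m2 [m3 [m4 [VE ab0 m0]]]]]]]]]]] := borel_basis VB dV aV nnil.
set x := bor a _ _ _ _ _ in VE; set y := bor 0 _ _ _ _ _ in VE.
have [l xy] : exists l, x *m y - y *m x = l *: y.
  have : x *m y - y *m x \in V.
    apply: sV; rewrite VE; apply/span2P.
      by exists 1, 0; rewrite scale1r scale0r addr0.
    by exists 0, 1; rewrite scale1r scale0r add0r.
  (* The bracket has no torus part while x has one, so the coefficient k of x is zero. *)
  rewrite VE => /span2P[k [l E]]; exists l; rewrite E; suff -> : k = 0 by rewrite scale0r add0r.
  move: E; rewrite bor_comm bor_lin => /bor_inj[/esym/eqP + /esym/eqP + _ _].
  rewrite !mulr0 !addr0 !mulf_eq0; move: ab0; rewrite pair_neq0.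
  by case: (k =P 0) => //= _; case: (a == 0); case: (b == 0).
have [g gS [gB [p' [q' [r' [s' [gx H]]]]]]] := borel_reduce a b p q r s two_neq0.
have [m1' [m2' [m3' [m4' gy]]]] := gB 0 0 m1 m2 m3 m4.
have gU := Sp4_unit gS.
have VW : equivalent V <<[:: bor a b p' q' r' s'; bor 0 0 m1' m2' m3' m4']>>%VS.
  by rewrite VE; apply: equivalent_span gS gx gy.
apply: (equivalent_to_model_trans VW).
apply: (classify_pair (l := l)) => //.
- exact: equivalent_anisotropic VW aV.
- apply: contra_neq m0 => -[n1 n2 n3 n4].
  have /bor_inj[_ _ -> [-> -> ->] //] : y = bor 0 0 0 0 0 0.
  by rewrite bor0 -(mulKmx gU y) gy n1 n2 n3 n4 bor0 mul0mx mulmx0.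
- exact: bracket_conj gU gx gy xy.
Qed.

(** * The three models are subalgebras *)

Lemma is_subalgebra_span (x y : 'M[F]_4) (l : F) :
  {subset <<[:: x; y]>>%VS <= @sp4 F} -> x *m y - y *m x = l *: y ->
  is_subalgebra <<[:: x; y]>>%VS.
Proof.
move=> S E; split=> // _ _ /span2P[k [m ->]] /span2P[k' [m' ->]].
(* By bilinearity and antisymmetry the bracket is the determinant k m' - m k' times [x, y]. *)
apply/span2P; exists 0, ((k * m' - m * k') * l).
rewrite scale0r add0r -scalerA -E !mulmxDl !mulmxDr -!scalemxAl -!scalemxAr !scalerA.
rewrite [k' * k]mulrC [m' * m]mulrC [k' * m]mulrC [m' * k]mulrC.
rewrite scalerBr !scalerBl.
set A := x *m x; set B := x *m y; set C := y *m x; set D := y *m y.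
apply/matrixP=> i j; rewrite !mxE; ring.
Qed.

Lemma is_subalgebra_bor (a b p q r s m1 m2 m3 m4 l : F) :
  let x := bor a b p q r s in let y := bor 0 0 m1 m2 m3 m4 in
  x *m y - y *m x = l *: y -> is_subalgebra <<[:: x; y]>>%VS.
Proof.
move=> x y; apply: is_subalgebra_span => _ /span2P[k [m ->]].
by rewrite bor_lin bor_in_sp4.
Qed.

Lemma alg1_subalgebra : is_subalgebra (alg1 F).
Proof.
rewrite alg1E; apply: (is_subalgebra_bor (l := 2)).
by rewrite bor_comm bor_scale; congr bor; ring.
Qed.

Lemma alg2_subalgebra : is_subalgebra (alg2 F).
Proof.
rewrite alg2E; apply: (is_subalgebra_bor (l := 1)).
by rewrite bor_comm bor_scale; congr bor; ring.
Qed.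

Lemma alg3_subalgebra : is_subalgebra (alg3 F).
Proof.
rewrite alg3E; apply: (is_subalgebra_bor (l := 2)).
by rewrite bor_comm bor_scale; congr bor; ring.
Qed.

(** * Pairwise inequivalence of the models *)

Lemma bor_singular a p q r s : bor a 0 p 0 r s \notin unitmx.
Proof.
(* The last row of the matrix is zero, so the last diagonal entry of its product with an inverse
   would be 0 instead of 1. *)
apply/negP=> /mulmxV /matrixP /(_ 3 3); rewrite !mxE big1 => [/eqP|i _].
  by rewrite eq_sym oner_eq0.
rewrite mxE; case: i => [[|[|[|[|]]]] //= ?]; rewrite ?oppr0 mul0r //.
Qed.

Lemma bor_unit : bor 1 1 0 1 0 0 \in @unitmx F 4.
Proof.
suff /mulmx1_unit[] : bor 1 1 0 1 0 0 *m bor 1 1 0 (-1) 0 0 = 1%:M :> 'M[F]_4 by [].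
have -> : 1%:M = mx4 [:: [:: 1; 0; 0; 0]; [:: 0; 1; 0; 0];
                         [:: 0; 0; 1; 0]; [:: 0; 0; 0; 1]] :> 'M[F]_4.
  apply/matrixP=> i j; rewrite !mxE.
  by mx4_cases i j.
by mx4_ring.
Qed.

Lemma alg1_not_equivalent V : (forall X, X \in V -> X \notin unitmx) -> ~ equivalent (alg1 F) V.
Proof.
move=> sV [g gS E]; have gU := Sp4_unit gS.
have /sV/negP[] : g *m bor 1 1 0 1 0 0 *m invmx g \in V.
  apply/E; exists (bor 1 1 0 1 0 0) => //; rewrite alg1E; apply/span2P.
  by exists 1, 0; rewrite scale1r scale0r addr0.
by rewrite !unitmx_mul gU bor_unit unitmx_inv.
Qed.

Lemma alg12_not_equivalent : ~ equivalent (alg1 F) (alg2 F).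
Proof.
apply: alg1_not_equivalent => X; rewrite alg2E => /span2P[k [m ->]].
by rewrite bor_lin !mulr0 !addr0 bor_singular.
Qed.

Lemma alg13_not_equivalent : ~ equivalent (alg1 F) (alg3 F).
Proof.
apply: alg1_not_equivalent => X; rewrite alg3E => /span2P[k [m ->]].
by rewrite bor_lin !mulr0 !addr0 bor_singular.
Qed.

(** An element of [alg2 F] with coefficients k and m has, up to sign, the two-by-two minors k^2 and
    m^2, so if nonzero it has rank at least two and is not conjugate to X_{alpha+2beta}. *)
Lemma alg23_not_equivalent : ~ equivalent (alg2 F) (alg3 F).
Proof.
case=> g gS E; have gU := Sp4_unit gS.
have /E[X] : @X_alpha_2beta F \in alg3 F.
  by rewrite memv_span // !inE eqxx orbT.
rewrite alg2E => /span2P[k [m]]; rewrite bor_lin !mulr0 !mulr1 !addr0 !add0r => XE gX.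
(* E_{13} is a column times a row, and conjugating back factors X in the same way. *)
have XE' : X = (invmx g *m delta_mx 0 (0 : 'I_1)) *m (delta_mx (0 : 'I_1) 2 *m g).
  rewrite mulmxA -(mulmxA (invmx g)) mul_delta_mx -/(@X_alpha_2beta F) gX.
  by rewrite !mulmxA mulVmx // mul1mx mulmxKV.
(* X has rank one, so its 2x2 minors vanish. *)
set u := invmx g *m _ in XE'; set v := _ *m g in XE'.
have minor i j i' j' : X i j * X i' j' = X i j' * X i' j.
  by rewrite XE' !mxE !big_ord_recl !big_ord0; ring.
have k0 : k = 0.
  have := minor 0 0 2 2; rewrite XE !mxE /= mulr0 mulrN => /eqP.
  by rewrite oppr_eq0 mulf_eq0 orbb => /eqP.
have m0 : m = 0.
  have := minor 0 3 1 2; rewrite XE !mxE /= mul0r => /eqP.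
  by rewrite mulf_eq0 orbb => /eqP.
move: gX; rewrite XE k0 m0 bor0 mulmx0 mul0mx => /matrixP/(_ 0 2)/eqP.
by rewrite !mxE oner_eq0.
Qed.

End Classification.

Local Open Scope complex_scope.

Theorem theorem6p9 (R : realType) :
  (forall V : {vspace 'M[R[i]]_4},
     is_subalgebra V -> (V <= borel R[i])%VS -> \dim V = 2%N ->
     (forall X, X \in V -> semisimple_mx X -> X = 0) ->
     ~ (forall X, X \in V -> nilpotent_mx X) ->
     [\/ equivalent V (alg1 R[i]), equivalent V (alg2 R[i])
       | equivalent V (alg3 R[i])])
  /\ [/\ is_subalgebra (alg1 R[i]), is_subalgebra (alg2 R[i])
       & is_subalgebra (alg3 R[i])]
  /\ [/\ ~ equivalent (alg1 R[i]) (alg2 R[i]),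
         ~ equivalent (alg1 R[i]) (alg3 R[i])
       & ~ equivalent (alg2 R[i]) (alg3 R[i])].
Proof.
split; first by move=> V; exact: classify.
split; split.
- exact: alg1_subalgebra.
- exact: alg2_subalgebra.
- exact: alg3_subalgebra.
- exact: alg12_not_equivalent.
- exact: alg13_not_equivalent.
- exact: alg23_not_equivalent.
Qed.
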